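(* Let $N\ge0$ be an integer and let $a,b$ be real parameters that are generic, i.e. such that no denominator in the functions below vanishes. For all $m,n\in\{0,\dots,N\}$ the rational function $\mathcal V_m(n;a,b,N)$ of Hahn type satisfies the difference equation $$\tilde{\mathcal B}_{n,m}\big(\mathcal V_m(n+1;a,b,N)-\mathcal V_m(n;a,b,N)\big)+\tilde{\mathcal D}_n\big(\mathcal V_m(n-1;a,b,N)-\mathcal V_m(n;a,b,N)\big)$$ $$=m(m+b-N)(-a+b+2)\,\mathcal V_m(n;a,b,N),$$ where $$\tilde{\mathcal B}_{n,m}=(N-n-m+a-b-2)(-n+m+a-2)(N-n),$$ $$\tilde{\mathcal D}_n=-(N-n+a-b-2)(N-n+a-b-1)\,n.$$
   Context: Rational functions of Hahn type: for $m=0,\dots,N$, $$\mathcal U_m(x;a,b,N)=\frac{(-1)^m(-N)_m}{(b+1)_m}\sum_{\ell=0}^m\frac{(-x)_\ell(-m)_\ell(b+m-N)_\ell}{\ell!\,(-N)_\ell(a-x)_\ell},\qquad \mathcal V_m(x;a,b,N)=\mathcal U_m(N-x;b+2-a,b,N)$$ (the sum is ${}_3F_2(-x,-m,b+m-N;-N,a-x;1)$), where $(x)_0=1$, $(x)_k=x(x+1)\cdots(x+k-1)$. Terms whose coefficient vanishes (the one with $\mathcal V_m(-1)$ for $n=0$, the one with $\mathcal V_m(N+1)$ for $n=N$) are omitted. *)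

(* Defs.v *)
From mathcomp Require Import all_boot all_order all_algebra.
From mathcomp Require Import reals.

Set Implicit Arguments.
Unset Strict Implicit.
Unset Printing Implicit Defensive.

Import Order.TTheory GRing.Theory Num.Theory.
Local Open Scope ring_scope.

(* The Pochhammer symbol (x)_k = x (x + 1) ... (x + k - 1). *)
Definition poch (R : realType) (x : R) (k : nat) : R :=
  \prod_(i < k) (x + i%:R).

(* The sum is 3F2(-x, -m, b + m - N; -N, a - x; 1), which terminates at l = m. *)
Definition hahnU (R : realType) (m : nat) (x a b : R) (N : nat) : R :=
  (-1) ^+ m * poch (- N%:R) m / poch (b + 1) m *
  \sum_(l < m.+1)
    (poch (- x) l * poch (- m%:R) l * poch (b + m%:R - N%:R) l) /
    (l`!%:R * poch (- N%:R) l * poch (a - x) l).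

Definition hahnV (R : realType) (m : nat) (x a b : R) (N : nat) : R :=
  hahnU m (N%:R - x) (b + 2 - a) b N.

(* No denominator occurring in hahnV m n a b N vanishes, for m, n = 0, ..., N.
   The remaining denominators l! and (-N)_l, with l <= m <= N, are never zero. *)
Definition generic (R : realType) (a b : R) (N : nat) : Prop :=
  forall m n l : nat, (l <= m)%N -> (m <= N)%N -> (n <= N)%N ->
    poch (b + 1) m != 0 /\ poch (b + 2 - a - (N%:R - n%:R)) l != 0.

Definition Btilde (R : realType) (n m : nat) (a b : R) (N : nat) : R :=
  (N%:R - n%:R - m%:R + a - b - 2) * (- n%:R + m%:R + a - 2) *
  (N%:R - n%:R).

(* Btilde vanishes at n = N and Dtilde at n = 0. As division is total, hahnV has
   some value at N + 1 and at -1 too, and its product with the zero coefficient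
   is 0: this is how terms with a vanishing coefficient are omitted. *)
Definition Dtilde (R : realType) (n : nat) (a b : R) (N : nat) : R :=
  - (N%:R - n%:R + a - b - 2) * (N%:R - n%:R + a - b - 1) * n%:R.

(* Main.v *)
(** Put [y = N - n], [c = b + 2 - a - y], [e = b + m - N] and
    [t_l = (-y)_l / (c)_l], so that [V_m(n)] is a multiple of
    [\sum_l w_l t_l] with [w_l = (-m)_l (e)_l / (l! (-N)_l)]. Both shifts
    [n -> n + 1] and [n -> n - 1] multiply [t_l] by a rational factor, and once
    multiplied by their coefficients both differences are divisible by
    [c + y = b + 2 - a]. With this factor removed, the recurrence
    [w_(l+1) (l + 1) (l - N) = w_l (l - m) (l + e)] makes the sum over [l]
    telescope, and the remaining boundary term contains the factor [m - m]. *)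
Require Import Defs.
From mathcomp Require Import all_boot all_order all_algebra.
From mathcomp Require Import reals.
From mathcomp Require Import ring.
Import GRing.Theory Num.Theory.
Local Open Scope ring_scope.

Lemma poch0 (R : realType) (x : R) : poch x 0 = 1.
Proof. by rewrite /poch big_ord0. Qed.

Lemma pochS (R : realType) (x : R) k : poch x k.+1 = poch x k * (x + k%:R).
Proof. by rewrite /poch big_ord_recr. Qed.

Lemma pochSl (R : realType) (x : R) k : poch x k.+1 = x * poch (x + 1) k.
Proof.
rewrite /poch big_ord_recl addr0; congr (_ * _); apply: eq_bigr => i _.
by rewrite -addrA -natr1 [1 + _]addrC.
Qed.

Lemma poch_shift (R : realType) (x : R) k :
  x * poch (x + 1) k = poch x k * (x + k%:R).
Proof. by rewrite -pochSl pochS. Qed.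

Lemma poch_neg_neq0 (R : realType) (N k : nat) :
  (k <= N)%N -> poch (- N%:R : R) k != 0.
Proof.
move=> kN; rewrite /poch; apply/prodf_neq0 => i _.
by rewrite addrC subr_eq0 eqr_nat neq_ltn (leq_trans (ltn_ord i) kN).
Qed.

Lemma natr_poch_opp0 (R : realType) (y : R) l :
  y = 0 -> l%:R * poch (- y) l = 0.
Proof.
by move=> ->; case: l => [|l]; rewrite ?mul0r // pochSl oppr0 mul0r mulr0.
Qed.

Section Shifts.
Variables (R : realType) (c y : R).

(** The shift from [n] to [n + 1] turns [y] into [y - 1] and [c] into [c + 1], which multiplies
    [t_l] by [c (l - y) / (- y (c + l))]. For [y = 0], i.e. [n = N], the shifted denominators may
    vanish, but the factors [y] and [l (-y)_l] make both sides zero. *)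
Lemma poch_ratio_up l :
  (y != 0 -> c != 0 /\ poch c l.+1 != 0) ->
  y * (poch (- y + 1) l / poch (c + 1) l - poch (- y) l / poch c l) =
  - (c + y) * (l%:R * poch (- y) l / poch c l.+1).
Proof.
have [y0 _|y0 /(_ isT)[c0 Q0]] := eqVneq y 0.
  by rewrite natr_poch_opp0 // {1}y0 !mul0r mulr0.
have := Q0; rewrite pochS mulf_eq0 negb_or => /andP[Q0' cl0].
have -> : poch (c + 1) l = poch c l * (c + l%:R) / c.
  by rewrite -poch_shift mulrAC mulfV // mul1r.
have -> : poch (- y + 1) l = poch (- y) l * (- y + l%:R) / - y.
  by rewrite -poch_shift mulrAC mulfV ?mul1r // oppr_eq0.
by field; rewrite y0 c0 Q0' cl0.
Qed.

(** This is the shift from [n] to [n - 1]. Since [l - 1 - y] can vanish, the result is expressed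
    through [(-y)_(l-1)] rather than as a multiple of [t_l]; the factor [l] disposes of [l = 0]. *)
Lemma poch_ratio_down l :
  c != 1 -> poch c l != 0 ->
  (c - 1) * (poch (- y - 1) l / poch (c - 1) l - poch (- y) l / poch c l) =
  - (c + y) * (l%:R * poch (- y) l.-1 / poch c l).
Proof.
case: l => [|l]; first by rewrite !poch0 subrr !mul0r !mulr0.
rewrite -subr_eq0 => c1; rewrite pochS mulf_eq0 negb_or => /andP[Q0 cl0].
rewrite [poch (_ - 1) _]pochSl [poch (c - 1) _]pochSl !subrK pochS -natr1 /=.
by field; rewrite c1 Q0 cl0.
Qed.

End Shifts.

Section Telescoping.
Variables (R : realType) (N m : nat) (c y e : R).
Hypothesis mN : (m <= N)%N.

Definition hahn_weight l : R :=
  poch (- m%:R) l * poch e l / (l`!%:R * poch (- N%:R) l).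

Lemma hahn_weightS k : (k < N)%N ->
  hahn_weight k.+1 * (k.+1%:R * (k%:R - N%:R)) =
  hahn_weight k * ((k%:R - m%:R) * (k%:R + e)).
Proof.
move=> kN; rewrite /hahn_weight factS natrM !pochS.
have k0 : (k`!%:R : R) != 0 by rewrite pnatr_eq0 -lt0n fact_gt0.
have k1 : (k.+1%:R : R) != 0 by rewrite pnatr_eq0.
have P0 := poch_neg_neq0 R N k (ltnW kN).
have kN0 : - N%:R + k%:R != 0 :> R.
  by rewrite addrC subr_eq0 eqr_nat neq_ltn kN.
rewrite -natr1 in k1 *.
by field; rewrite k0 k1 P0 kN0.
Qed.

(* Stated without a non-vanishing hypothesis since [c + l] may vanish for
   [y = 0], where both sides are [0] when [0 < l]. *)
Hypothesis ratioS : forall l, (l <= m)%N ->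
  poch (- y) l / poch c l = (c + l%:R) * (poch (- y) l / poch c l.+1).

(** Multiplied by [c + y], the bracket is the contribution of index [l] to the difference of the two
    sides of the equation. The closed form of the partial sums is proved by induction, and its
    factor [k - m] vanishes at [k = m]. *)
Lemma hahn_telescope k : (k <= m)%N ->
  \sum_(l < k.+1) hahn_weight l *
    ((N%:R - y) * c * (l%:R * poch (- y) l.-1 / poch c l)
     - (c + m%:R) * (c - e) * (l%:R * poch (- y) l / poch c l.+1)
     - m%:R * e * (poch (- y) l / poch c l)) =
  c * (hahn_weight k * ((k%:R - m%:R) * (k%:R + e))) *
    (poch (- y) k / poch c k.+1).
Proof.
elim: k => [|k IH] km.
  rewrite big_ord_recl big_ord0 addr0 /= ratioS // !poch0.
  by ring.
rewrite big_ord_recr /= IH ?(ltnW km) // -hahn_weightS ?(leq_trans km) //.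
have H := ratioS _ km.
have H' : poch (- y) k.+1 / poch c k.+1 =
    (k%:R - y) * (poch (- y) k / poch c k.+1).
  by rewrite pochS; ring.
rewrite -!(mulrA _ (poch _ _)) H; rewrite {}H in H'.
move: (poch (- y) k.+1 / _) (poch (- y) k / _) H' => S S' H'.
rewrite -!natr1 in H' *.
apply/eqP; rewrite -subr_eq0; apply/eqP.
(* The two sides differ by a multiple of the relation [H'] between [S] and [S']. *)
transitivity (hahn_weight k.+1 * c * (k%:R + 1) *
   ((c + (k%:R + 1)) * S - (k%:R - y) * S') * -1).
  by ring.
by rewrite H' subrr mulr0 mul0r.
Qed.

End Telescoping.

Lemma hahnV_weightE (R : realType) (a b : R) (N m : nat) (x : R) :
  hahnV m x a b N =
  (-1) ^+ m * poch (- N%:R) m / poch (b + 1) m *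
  \sum_(l < m.+1) hahn_weight R N m (b + m%:R - N%:R) l *
    (poch (- (N%:R - x)) l / poch (b + 2 - a - (N%:R - x)) l).
Proof.
rewrite /hahnV /hahnU /hahn_weight; congr (_ * _); apply: eq_bigr => l _.
by rewrite !invfM; ring.
Qed.

Lemma generic_poch_neq0 (R : realType) (a b : R) (N n l : nat) :
  generic a b N -> (l <= N)%N -> (n <= N)%N ->
  poch (b + 2 - a - (N%:R - n%:R)) l != 0.
Proof. by move=> hab lN nN; case: (hab l n l (leqnn l) lN nN). Qed.

Theorem proposition10 (R : realType) (N : nat) (a b : R)
  (hab : generic a b N) (m n : nat) (hm : (m <= N)%N) (hn : (n <= N)%N) :
  Btilde n m a b N *
    (hahnV m (n%:R + 1) a b N - hahnV m n%:R a b N) +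
  Dtilde n a b N *
    (hahnV m (n%:R - 1) a b N - hahnV m n%:R a b N) =
  m%:R * (m%:R + b - N%:R) * (- a + b + 2) * hahnV m n%:R a b N.
Proof.
(* For [m = 0] the function is constant and both sides vanish; for [m > 0] genericity may be used
   with [l = 1], which gives [c != 0]. *)
rewrite !hahnV_weightE; have [->|m_gt0] := posnP m.
  by rewrite !big_ord_recl !big_ord0 !poch0; ring.
pose y : R := N%:R - n%:R; pose c : R := b + 2 - a - y.
pose e : R := b + m%:R - N%:R.
have poch_c l : (l <= m)%N -> poch c l != 0.
  by move=> lm; apply: generic_poch_neq0; rewrite // (leq_trans lm).
have c0 : c != 0 by have := poch_c 1%N m_gt0; rewrite pochS poch0 mul1r addr0.
(* As [l + 1] may exceed [N], [(c)_(l+1)] is split as [c (c+1)_l], whose second factor is a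
   denominator at [n + 1 <= N]. *)
have poch_up l : (l <= m)%N -> y != 0 -> c != 0 /\ poch c l.+1 != 0.
  move=> lm; rewrite subr_eq0 eqr_nat eq_sym => nN; split=> //.
  have nN' : (n < N)%N by rewrite ltn_neqAle nN.
  have := generic_poch_neq0 R a b N n.+1 l hab (leq_trans lm hm) nN'.
  have -> : b + 2 - a - (N%:R - n.+1%:R) = c + 1 by rewrite /c /y -natr1; ring.
  by rewrite pochSl => Q0; rewrite mulf_neq0.
have c1 : n != 0%N -> c != 1.
  rewrite -lt0n => n0.
  have := generic_poch_neq0 R a b N n.-1 1 hab (leq_trans m_gt0 hm)
    (leq_trans (leq_pred _) hn).
  have -> : b + 2 - a - (N%:R - n.-1%:R) = c - 1.
    by rewrite /c /y -[in n%:R](prednK n0) -natr1; ring.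
  by rewrite pochS poch0 mul1r addr0 subr_eq0.
have ratioS l : (l <= m)%N ->
    poch (- y) l / poch c l = (c + l%:R) * (poch (- y) l / poch c l.+1).
  move=> lm; have [y0|y0] := eqVneq y 0.
    case: l {lm} => [|l]; last by rewrite pochSl y0 oppr0 !mul0r mulr0.
    by rewrite pochS !poch0 addr0; field.
  have [_] := poch_up l lm y0; rewrite pochS mulf_eq0 negb_or => /andP[Q0 cl0].
  by field; rewrite Q0 cl0.
have := hahn_telescope R N m c y e hm ratioS m (leqnn m).
rewrite subrr mul0r !mulr0 mul0r.
under eq_bigr do rewrite 2![hahn_weight _ _ _ _ _ * _]mulrBr
  (mulrCA _ ((N%:R - y) * c)) (mulrCA _ ((c + m%:R) * (c - e)))
  (mulrCA _ (m%:R * e)).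
rewrite !sumrB -!mulr_sumr -/y -/c -/e => tele.
set V := \sum_(l < m.+1) hahn_weight R N m e l * (poch (- y) l / poch c l)
  in tele *.
set Vup := \sum_(l < m.+1) _ * (_ / poch (_ - (N%:R - (n%:R + 1))) _).
set Vdown := \sum_(l < m.+1) _ * (_ / poch (_ - (N%:R - (n%:R - 1))) _).
set Sdown := \sum_(l < m.+1) _ in tele; set Sup := \sum_(l < m.+1) _ in tele.
have up : y * (Vup - V) = - (c + y) * Sup.
  rewrite -sumrB !mulr_sumr; apply: eq_bigr => l _.
  rewrite -mulrBr [LHS]mulrCA [RHS]mulrCA -poch_ratio_up.
    congr (_ * (_ * (poch _ _ / poch _ _ - _))); rewrite /c /y; ring.
  exact: poch_up (ltn_ord l).
(* The factor [N - y = n] is kept because [c - 1] is only known to be nonzero for [n != 0]. *)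
have down : (N%:R - y) * (c - 1) * (Vdown - V) = - (N%:R - y) * (c + y) * Sdown.
  have -> : N%:R - y = n%:R by rewrite /y; ring.
  have [->|n0] := eqVneq n 0%N; first by rewrite oppr0 !mul0r.
  rewrite mulNr -mulrN -!mulrA; congr (_ * _).
  rewrite -sumrB !mulr_sumr; apply: eq_bigr => l _.
  rewrite -mulrBr [LHS]mulrCA [RHS]mulrCA.
  rewrite -(poch_ratio_down _ _ _ _ (c1 n0) (poch_c l (ltn_ord l))).
  by congr (_ * (_ * (poch _ _ / poch _ _ - _))); rewrite /c /y; ring.
have -> : Btilde n m a b N = (c + m%:R) * (c - e) * y.
  by rewrite /Btilde /c /e /y; ring.
have -> : Dtilde n a b N = - c * ((N%:R - y) * (c - 1)).
  by rewrite /Dtilde /c /y; ring.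
have -> : m%:R * (m%:R + b - N%:R) * (- a + b + 2) = m%:R * e * (c + y).
  by rewrite /c /e; ring.
rewrite -!mulrBr !(mulrCA _ (_ / poch (b + 1) m)) -mulrDr; congr (_ * _).
rewrite -!(mulrA _ y) up -(mulrA (- c)) down.
(* The difference of the two sides is now [c + y] times the vanishing telescoped sum [tele]. *)
apply/eqP; rewrite -subr_eq0; apply/eqP.
by rewrite -[RHS](mulr0 (c + y)) -tele; ring.
Qed.
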